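(* Let $r>\sqrt2$ and $\mu_x,\mu_y,\lambda>0$. For $n\in\mathbb{N}$ let $$\theta_n:=\mathbb{P}\big(\mathcal{C}_o\cap\partial([-n,n]^2)\neq\emptyset\big),$$ where $\mathcal{C}_o\subset\mathbb{R}^2$ is the connected component of the Manhattan grid model $\Xi(r,\mu_x,\mu_y,\lambda)$ containing the origin. Then $$\liminf_{n\to\infty}\ \lfloor\lambda^{-1}\log n\rfloor!\,\cdot\,n^{\lambda^{-1}\log(\min\{\mu_x,\mu_y\})}\cdot\theta_n>0,$$ and in particular, for every $\varepsilon>0$, $$\liminf_{n\to\infty}\ n^{(1+\varepsilon)\lambda^{-1}\log(\log n)}\cdot\theta_n=\infty.$$
   Context: Manhattan grid model (MGM): Let $r,\mu_x,\mu_y,\lambda>0$ and let $\Phi^{(x)},\Phi^{(y)}\subset\mathbb{R}$ be independent homogeneous Poisson point processes with intensities $\mu_x$ and $\mu_y$. Define the random measure $\Lambda$ on Borel sets $A\subset\mathbb{R}^2$ by $$\Lambda(A):=\int_{\mathbb{R}}\int_{\mathbb{R}}\mathbf 1_A(x,y)\,dy\,\Phi^{(x)}(dx)+\int_{\mathbb{R}}\int_{\mathbb{R}}\mathbf 1_A(x,y)\,dx\,\Phi^{(y)}(dy).$$ Conditionally on $\Phi^{(x)},\Phi^{(y)}$, let $\Psi\subset\mathbb{R}^2$ be a Poisson point process with intensity measure $\lambda\Lambda$. The MGM is the random set $$\Xi(r,\mu_x,\mu_y,\lambda):=\{z\in\mathbb{R}^2:\exists P\in\Psi,\ \|z-P\|<r\},$$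 with $\|\cdot\|$ the Euclidean norm. The component $\mathcal{C}_o$ is understood to be empty if the origin is not in $\Xi$. Here $\lfloor\cdot\rfloor!$ is the factorial of the integer part. *)

(* Defs.v *)
From HB Require Import structures.
From mathcomp Require Import all_boot all_order all_algebra.
From mathcomp Require Import all_classical all_reals all_analysis.
From mathcomp Require Import measurable_realfun.

Set Implicit Arguments.
Unset Strict Implicit.
Unset Printing Implicit Defensive.

Import Order.TTheory GRing.Theory Num.Theory.
Import numFieldNormedType.Exports.

Local Open Scope classical_set_scope.
Local Open Scope ring_scope.

Definition bounded_borel1 {R : realType} : set (set R) :=
  [set B : set R | measurable B /\ bounded_set B].

(* Boundedness in the product norm, and the product of the Borel
   sigma-algebras, which is the Borel sigma-algebra of the plane. *)
Definition bounded_borel2 {R : realType} : set (set (R * R)) :=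
  [set B : set (R * R) | measurable B /\ bounded_set B].

(* A point process on [S] is a random subset [Phi : T -> set S] whose points are
   counted in the sets of a class [bb], to be taken as the bounded Borel sets of
   [S] ([bounded_borel1] for the line, [bounded_borel2] for the plane). *)
Section point_processes.
Context {d : measure_display} {T : measurableType d} {S : choiceType}.
Variable bb : set (set S).
Implicit Types (Phi : T -> set S) (B : set S).

Definition count_event Phi B (n : nat) : set T :=
  [set w | (Phi w `&` B #= `I_n)%card].

(* The counts in bounded Borel sets are finite and, having values in [nat],
   they are measurable as soon as their fibers are. *)
Definition point_process Phi : Prop :=
  (forall w B, bb B -> finite_set (Phi w `&` B)) /\
  (forall B n, bb B -> measurable (count_event Phi B n)).

Definition sigma_point_process Phi : set (set T) :=
  <<s [set E | exists B n, bb B /\ E = count_event Phi B n] >>.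

End point_processes.

(* Unlike the library's [poisson_pmf], which is constantly 1 at rate 0, this is
   the mass function of the Dirac mass at 0 when [a = 0]. *)
Definition poisson_weight {R : realType} (a : R) (n : nat) : R :=
  expR (- a) * a ^+ n / n`!%:R.

Section poisson_processes.
Context {R : realType} {d : measure_display} {T : measurableType d}
  {S : choiceType}.
Variables (P : probability T R) (bb : set (set S)).
Implicit Types (Phi Psi : T -> set S) (B : set S).

Definition poisson_process (nu : set S -> \bar R) Phi : Prop :=
  [/\ point_process bb Phi,
      forall B n, bb B ->
        P (count_event Phi B n) = (poisson_weight (fine (nu B)) n)%:E
    & forall k (B : 'I_k -> set S) (n : 'I_k -> nat),
        (forall i, bb (B i)) -> trivIset setT B ->
        P (\bigcap_i count_event Phi (B i) (n i)) =
        (\prod_(i < k) P (count_event Phi (B i) (n i)))%E].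

(* [f] is a version of the conditional probability of [A] given [G]. *)
Definition cond_probability (G : set (set T)) (A : set T) (f : T -> R) : Prop :=
  (forall Y : set R, measurable Y -> G (f @^-1` Y)) /\
  (forall E, G E -> P (A `&` E) = (\int[P]_(w in E) (f w)%:E)%E).

(* Conditionally on [G], [Psi] is a Poisson process with intensity [M w]: its
   counts in disjoint bounded Borel sets are independent Poisson variables, so
   that their conditional joint mass function is a product. *)
Definition cond_poisson_process (G : set (set T)) (M : T -> set S -> \bar R)
    Psi : Prop :=
  point_process bb Psi /\
  forall k (B : 'I_k -> set S) (n : 'I_k -> nat),
    (forall i, bb (B i)) -> trivIset setT B ->
    cond_probability G (\bigcap_i count_event Psi (B i) (n i))
      (fun w => \prod_(i < k) poisson_weight (fine (M w (B i))) (n i)).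

End poisson_processes.

Definition independent_sigma {R : realType} {d : measure_display}
    {T : measurableType d} (P : probability T R) (G H : set (set T)) : Prop :=
  forall E F, G E -> H F -> P (E `&` F) = (P E * P F)%E.

(* [X] are the abscissas of the vertical lines, [Y] the ordinates of the
   horizontal ones; a point set is identified with its counting measure. *)
Definition manhattan_measure {R : realType} (X Y : set R) (A : set (R * R)) :
    \bar R :=
  (\int[counting]_(x in X) \int[lebesgue_measure]_y (\1_A (x, y))%:E +
   \int[counting]_(y in Y) \int[lebesgue_measure]_x (\1_A (x, y))%:E)%E.

Definition manhattan_process {R : realType} {d : measure_display}
    {T : measurableType d} (P : probability T R) (mu_x mu_y lambda : R)
    (Phi_x Phi_y : T -> set R) (Psi : T -> set (R * R)) : Prop :=
  let G_x := sigma_point_process bounded_borel1 Phi_x in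
  let G_y := sigma_point_process bounded_borel1 Phi_y in
  [/\ poisson_process P bounded_borel1
        (fun B => (mu_x%:E * lebesgue_measure B)%E) Phi_x,
      poisson_process P bounded_borel1
        (fun B => (mu_y%:E * lebesgue_measure B)%E) Phi_y,
      independent_sigma P G_x G_y
    & cond_poisson_process P bounded_borel2 <<s G_x `|` G_y >>
        (fun w A => (lambda%:E * manhattan_measure (Phi_x w) (Phi_y w) A)%E)
        Psi].

(* The library's norm on [R * R] is the maximum norm. *)
Definition euclidean_norm {R : realType} (z : R * R) : R :=
  Num.sqrt (z.1 ^+ 2 + z.2 ^+ 2).

Definition manhattan_grid_model {R : realType} (r : R) (X : set (R * R)) :
    set (R * R) :=
  [set z | exists2 p, X p & euclidean_norm (z - p) < r].

Definition boundary {U : topologicalType} (A : set U) : set U :=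
  closure A `\` interior A.

Definition square {R : realType} (n : nat) : set (R * R) :=
  `[- n%:R, n%:R] `*` `[- n%:R, n%:R].

(* [connected_component A x] is empty when [x] is not in [A]. *)
Definition theta {R : realType} {d : measure_display} {T : measurableType d}
    (P : probability T R) (r : R) (Psi : T -> set (R * R)) (n : nat) : \bar R :=
  P [set w | connected_component (manhattan_grid_model r (Psi w)) (0, 0)
             `&` boundary (square n) !=set0].

(* Main.v *)
(** A horizontal strip [R x [0, 1/2]] carrying [k] lines contains, in each box
    of length [6/5], a Poisson number of points of mean at least
    [6/5 lambda k].  For [k] about [ln n / (6/5 lambda)] a given box is empty
    with conditional probability at most [1/(2n)], so by the union bound the
    first [n] boxes are all hit with conditional probability at least [1/2], and
    since [sqrt 2 < r] the balls around the points hit connect the origin to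
    abscissa [n].  Hence [theta_n] is at least half the probability that a Poisson
    variable of mean [mu_y / 2] equals [k].  As the box length exceeds [1], [k!]
    is smaller than [floor(ln n / lambda)!] by a superpolynomial factor, which
    absorbs all powers of [n]: both lower limits are infinite, whatever the
    sign of [ln (min mu_x mu_y)]. *)

Require Import Defs.
From HB Require Import structures.
From mathcomp Require Import all_boot all_order all_algebra.
From mathcomp Require Import all_classical all_reals all_analysis.
From mathcomp Require Import measurable_realfun.
From mathcomp Require Import ring lra.

Set Implicit Arguments.
Unset Strict Implicit.
Unset Printing Implicit Defensive.

Import Order.TTheory GRing.Theory Num.Theory.
Import numFieldNormedType.Exports.

Local Open Scope classical_set_scope.
Local Open Scope ring_scope.

(** * The Euclidean norm and the connectedness of its balls *)

Section euclidean_norm.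
Context {R : realType}.
Implicit Types p q z : R * R.

Lemma euclidean_norm_lt z (a : R) :
  0 < a -> (euclidean_norm z < a) = (z.1 ^+ 2 + z.2 ^+ 2 < a ^+ 2).
Proof.
move=> a0; have -> : a = Num.sqrt (a ^+ 2) by rewrite sqrtr_sqr gtr0_norm.
by rewrite /euclidean_norm ltr_sqrt ?sqr_sqrtr ?exprn_gt0 // ltW // exprn_gt0.
Qed.

Lemma euclidean_normD p q :
  euclidean_norm (p + q) <= euclidean_norm p + euclidean_norm q.
Proof.
rewrite /euclidean_norm; case: p q => [a b] [c e] /=.
have s2 (x y : R) : Num.sqrt (x ^+ 2 + y ^+ 2) ^+ 2 = x ^+ 2 + y ^+ 2.
  by rewrite sqr_sqrtr // addr_ge0 // sqr_ge0.
have := s2 (a + c) (b + e); have := s2 c e; have := s2 a b.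
have := sqrtr_ge0 (c ^+ 2 + e ^+ 2); have := sqrtr_ge0 (a ^+ 2 + b ^+ 2).
have := sqrtr_ge0 ((a + c) ^+ 2 + (b + e) ^+ 2).
set t := Num.sqrt ((a + c) ^+ 2 + _); set u := Num.sqrt (a ^+ 2 + _).
set v := Num.sqrt _ => t0 u0 v0 u2 v2 t2.
(* Cauchy-Schwarz, from Lagrange's identity: the defect of the squares is [(a * e - b * c) ^+ 2]. *)
have uv : a * c + b * e <= u * v.
  apply: le_trans (ler_norm _) _; rewrite -ler_sqr ?nnegrE ?mulr_ge0 //.
  rewrite -normrX ger0_norm ?sqr_ge0 // exprMn u2 v2.
  by have := sqr_ge0 (a * e - b * c); lra.
by rewrite -ler_sqr ?nnegrE ?addr_ge0 // t2; lra.
Qed.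

Lemma euclidean_normZ (t : R) z :
  euclidean_norm (t *: z) = `|t| * euclidean_norm z.
Proof.
rewrite /euclidean_norm /= -sqrtr_sqr -sqrtrM ?sqr_ge0 //.
by congr Num.sqrt; rewrite /GRing.scale /=; ring.
Qed.

Lemma euclidean_normB p q : euclidean_norm (p - q) = euclidean_norm (q - p).
Proof. by rewrite -opprB -scaleN1r euclidean_normZ normrN1 mul1r. Qed.

Lemma euclidean_norm_continuous : continuous (@euclidean_norm R).
Proof.
move=> z.
apply: (@continuous_comp _ _ _ (fun z : R * R => z.1 ^+ 2 + z.2 ^+ 2)).
  by apply: cvgD; apply: (@continuous_comp _ _ _ _ (fun x : R => x ^+ 2));
    [exact: cvg_fst|exact: exprn_continuous|exact: cvg_snd|
     exact: exprn_continuous].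
exact: sqrt_continuous.
Qed.

Definition euclidean_ball p (r : R) : set (R * R) :=
  [set z | euclidean_norm (z - p) < r].

Lemma open_euclidean_ball p r : open (euclidean_ball p r).
Proof.
rewrite (_ : euclidean_ball _ _ =
  (fun z => euclidean_norm (z - p)) @^-1` [set x | x < r])//.
apply: open_comp; last exact: open_lt.
move=> z _; apply: (@continuous_comp _ _ _ (fun z => z - p)).
  by apply: cvgB; [exact: cvg_id|exact: cvg_cst].
exact: euclidean_norm_continuous.
Qed.

(** The ball is a union of segments that all contain its centre. *)
Lemma connected_euclidean_ball p (r : R) : 0 < r ->
  connected (euclidean_ball p r).
Proof.
move=> r0; pose seg z := (fun t : R => p + t *: (z - p)) @` `[0, 1].
have -> : euclidean_ball p r = \bigcup_(z in euclidean_ball p r) seg z.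
  apply/seteqP; split=> [z pz|x [z pz] [t]].
    exists z => //; exists 1; rewrite /= ?in_itv/= ?ler01 ?lexx//.
    by rewrite scale1r addrC subrK.
  rewrite /= in_itv /= => /andP[t0 t1] <-; rewrite /euclidean_ball /=.
  rewrite addrC addKr euclidean_normZ ger0_norm //; apply: le_lt_trans pz.
  by rewrite ler_piMl // sqrtr_ge0.
apply: bigcup_connected.
  exists p => z pz; exists 0; rewrite /= ?in_itv/= ?lexx ?ler01//.
  by rewrite scale0r addr0.
move=> z pz; apply: connected_continuous_connected.
  exact: segment_connected.
apply: continuous_subspaceT => t; apply: cvgD; first exact: cvg_cst.
by apply: cvgZr_tmp.
Qed.

End euclidean_norm.

(** * The component of the origin described by chains of overlapping balls *)

Section reach.
Context {R : realType}.
Implicit Types (X A D : set (R * R)) (p q z : R * R).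

(** Ends of chains of [k] steps in [X] whose first ball contains the origin; two open balls of
    radius [r] meet exactly when their centres are closer than [r + r]. Recording the length of the
    chain allows induction on it. *)
Fixpoint reach (r : R) X (k : nat) : set (R * R) :=
  if k is k'.+1 then
    [set p | X p /\ exists2 q, reach r X k' q & euclidean_norm (p - q) < r + r]
  else X `&` euclidean_ball (0, 0) r.

Lemma euclidean_ball_meet (r : R) p q z :
  euclidean_ball p r z -> euclidean_ball q r z ->
  euclidean_norm (p - q) < r + r.
Proof.
rewrite /euclidean_ball /= => pz qz.
rewrite (_ : p - q = (p - z) + (z - q)); last by rewrite addrA subrK.
by apply: le_lt_trans (euclidean_normD _ _) _; rewrite ltrD // euclidean_normB.
Qed.

Lemma euclidean_ball_meet_ex (r : R) p q :
  euclidean_norm (p - q) < r + r ->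
  euclidean_ball p r `&` euclidean_ball q r !=set0.
Proof.
move=> pq; exists (2^-1 *: (p + q)).
have halfE : forall u : R * R, u = 2^-1 *: (u + u).
  by move=> [a b]; congr pair; rewrite /GRing.scale /=; lra.
have hn : forall u : R * R, euclidean_norm u < r + r ->
    euclidean_norm (2^-1 *: u) < r.
  by move=> u ?; rewrite euclidean_normZ ger0_norm ?invr_ge0//; lra.
split; rewrite /euclidean_ball /=.
  rewrite [X in _ - X]halfE -scalerBr opprD addrACA subrr add0r.
  by apply: hn; rewrite euclidean_normB.
by rewrite [X in _ - X]halfE -scalerBr opprD addrACA subrr addr0; exact: hn.
Qed.

(** Induction along the chain: the ball of [p] meets the previous ball at some [z], which already
    lies in the component of the origin, so that the components of [z] and of the origin
    coincide. *)
Lemma reach_component (r : R) X k p : 0 < r -> reach r X k p ->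
  euclidean_ball p r `<=` connected_component (manhattan_grid_model r X) (0, 0).
Proof.
move=> r0; elim: k p => [|k IH] p.
  move=> [Xp p0]; apply: connected_component_max.
  - by rewrite /euclidean_ball /= euclidean_normB.
  - by move=> z pz; exists p.
  - exact: connected_euclidean_ball.
move=> [Xp [q kq /euclidean_ball_meet_ex[z [pz qz]]]].
have Cz := IH _ kq _ qz.
suff -> : connected_component (manhattan_grid_model r X) (0, 0) =
    connected_component (manhattan_grid_model r X) z.
  apply: connected_component_max => //; first by move=> y py; exists p.
  exact: connected_euclidean_ball.
exact: same_connected_component.
Qed.

(** For the inclusion from left to right, the model is split into the balls [U] of reached points
    and the balls [V] of the others. Both are open, and they are disjoint because a common point
    would lengthen a chain. Hence [U] cuts out of the component a nonempty, relatively clopen part,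
    which is everything. *)
Lemma componentE (r : R) X : 0 < r ->
  connected_component (manhattan_grid_model r X) (0, 0) =
  \bigcup_k \bigcup_(p in reach r X k) euclidean_ball p r.
Proof.
move=> r0; apply/seteqP; split; last first.
  by move=> z [k _ [p /(reach_component r0) /[apply]]].
set C := connected_component _ _; set U := (X in _ `<=` X).
pose N := [set p | X p /\ forall k, ~ reach r X k p].
pose V := \bigcup_(p in N) euclidean_ball p r.
have oU : open U.
  by do 2 (apply: bigcup_open => ? _); exact: open_euclidean_ball.
have oV : open V by apply: bigcup_open => ? _; exact: open_euclidean_ball.
have UV z : U z -> ~ V z.
  move=> [k _ [p kp pz]] [q [Xq Nq] qz]; apply: (Nq k.+1); split=> //.
  by exists p => //; exact: euclidean_ball_meet qz pz.
have CUV : C `<=` U `|` V.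
  move=> z /connected_component_sub[p Xp pz].
  have [[k kp]|Np] := pselect (exists k, reach r X k p).
    by left; exists k => //; exists p.
  by right; exists p => //; split=> // k kp; apply: Np; exists k.
move=> z Cz.
(* An inhabited component contains the origin, whose covering ball starts a chain. *)
have C0 : C (0, 0) by case: Cz => B [B0 Bsub Bc] _; exists B.
suff CU : C `&` U = C by have: C z by []; rewrite -CU => -[].
apply: (@component_connected _ (manhattan_grid_model r X) (0, 0)).
- exists (0, 0); split=> //.
  have [p Xp p0] := connected_component_sub C0.
  exists 0 => //; exists p => //; split=> //.
  by rewrite /euclidean_ball /= euclidean_normB.
- by exists U.
- exists (~` V); first exact: open_closedC.
  apply/seteqP; split=> y [Cy]; first by move=> /UV.
  by case: (CUV _ Cy).
Qed.

(** This replaces a topological event by a countable union, over the length of the chain, of hits of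
    an open set, which is open whatever [D] is. Measurability is proved in this form. *)
Lemma component_meetE (r : R) X D : 0 < r ->
  (connected_component (manhattan_grid_model r X) (0, 0) `&` D !=set0) =
  exists k, reach r X k `&` \bigcup_(z in D) euclidean_ball z r !=set0.
Proof.
move=> r0; rewrite propeqE; split.
  rewrite componentE // => -[z [[k _ [p kp pz]] Dz]]; exists k, p; split=> //.
  by exists z => //; rewrite /euclidean_ball /= euclidean_normB.
move=> [k [p [kp [z Dz zp]]]]; exists z; split=> //.
apply: reach_component kp _ _ => //.
by rewrite /euclidean_ball /= euclidean_normB.
Qed.

End reach.

(** * Measurability of the connection event *)

Section measurability.
Context {R : realType}.

Lemma count_event0 d (T : measurableType d) (S : choiceType)
    (Phi : T -> set S) (B : set S) :
  count_event Phi B 0 = ~` [set w | Phi w `&` B !=set0].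
Proof.
apply/seteqP; split=> w; rewrite /count_event /= II0 card_eq0.
  by move=> /eqP ->; case.
by move=> /set0P/negP; rewrite negbK.
Qed.

Lemma measurable_hit d (T : measurableType d) (S : choiceType) bb
    (Phi : T -> set S) (B : set S) :
  point_process bb Phi -> bb B -> measurable [set w | Phi w `&` B !=set0].
Proof.
move=> [_ mPhi] bB; rewrite -[X in measurable X]setCK -count_event0.
exact: measurableC (mPhi _ _ bB).
Qed.

Lemma bounded_borel2_itv (a b c e : R) (x y x' y' : bool) :
  bounded_borel2 ([set` Interval (BSide x a) (BSide y b)] `*`
                  [set` Interval (BSide x' c) (BSide y' e)]).
Proof.
split; first by apply: measurableX; exact: measurable_itv.
pose m := `|a| + `|b| + `|c| + `|e|; exists m; split; first exact: num_real.
have h (s t u M : R) (i j : bool) : `|s| + `|t| <= M ->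
    [set` Interval (BSide i s) (BSide j t)] u -> `|u| <= M.
  move=> stM; rewrite /= itv_boundlr => /andP[su ut].
  have {}su : s <= u by case: i su; rewrite bnd_simp // => /ltW.
  have {}ut : u <= t by case: j ut; rewrite bnd_simp // => /ltW.
  apply: le_trans stM; rewrite ler_norml; have := ler_norm t.
  have := ler_norm (- s); rewrite normrN; have := normr_ge0 s.
  have := normr_ge0 t; lra.
move=> M mM -[u v] [/= uI vI]; rewrite prod_normE /= ge_max.
have := normr_ge0 a; have := normr_ge0 b; have := normr_ge0 c.
have := normr_ge0 e; move: mM; rewrite /m => mM e0 c0 b0 a0.
by apply/andP; split; [apply: h uI|apply: h vI]; lra.
Qed.

Lemma measurable_bigcup_countType d (T : measurableType d) (I : countType)
    (D : set I) (F : I -> set T) :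
  (forall i, measurable (F i)) -> measurable (\bigcup_(i in D) F i).
Proof.
move=> mF; rewrite bigcup_mkcond; apply: countable_bigcupT_measurable => // i.
by case: ifP.
Qed.

(** A countable base of the plane made of bounded Borel sets; it makes the unions below
    countable. *)
Definition rat_box (i : rat * rat * (rat * rat)) : set (R * R) :=
  `]ratr i.1.1, ratr i.1.2[ `*` `]ratr i.2.1, ratr i.2.2[.

Lemma rat_box_nbhs (p : R * R) (A : set (R * R)) : nbhs p A ->
  exists i, rat_box i p /\ rat_box i `<=` A.
Proof.
case: p => a b /nbhs_ballP[e /= e0 eA].
have ratE (x : R) : exists s t : rat, ratr s < x < ratr t /\
    forall y, ratr s < y < ratr t -> `|x - y| < e.
  have xe : x - e < x by lra.
  have ex : x < x + e by lra.
  have [s] := rat_in_itvoo xe; have [t] := rat_in_itvoo ex.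
  rewrite !in_itv /= => /andP[xt te] /andP[es sx].
  exists s, t; split; first by rewrite sx xt.
  move=> y /andP[sy yt]; rewrite ltr_norml; lra.
have [s [t [sat stA]]] := ratE a; have [u [v [ubv uvA]]] := ratE b.
exists (s, t, (u, v)); split; first by split; rewrite /= in_itv.
move=> [x y] [/= xst yuv]; apply: eA.
by split; [apply: stA|apply: uvA]; move: xst yuv; rewrite /= !in_itv.
Qed.

Lemma bounded_borel2_rat_box i : bounded_borel2 (rat_box i).
Proof. exact: bounded_borel2_itv. Qed.

(** The plane carries the product sigma-algebra, so an open set is written as a countable union of
    rational boxes. *)
Lemma open_measurable_plane (A : set (R * R)) : open A -> measurable A.
Proof.
move=> oA; have -> : A = \bigcup_(i in [set i | rat_box i `<=` A]) rat_box i.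
  apply/seteqP; split=> [p Ap|p [i iA ip]]; last exact: iA.
  by have [|i [ip iA]] := @rat_box_nbhs p A; [exact: open_nbhs_nbhs|exists i].
by apply: measurable_bigcup_countType => i; case: (bounded_borel2_rat_box i).
Qed.

Lemma bounded_borel2_setI (A B : set (R * R)) :
  bounded_borel2 A -> measurable B -> bounded_borel2 (A `&` B).
Proof.
move=> [mA [M [Mr bA]]] mB; split; first exact: measurableI.
by exists M; split=> // m /bA Am x [/Am].
Qed.

(* The induction works because consecutive points [p, q] of a chain, being at
   distance [< r + r], lie in rational boxes all of whose points are so close. *)
Lemma measurable_reach_hit d (T : measurableType d) (Psi : T -> set (R * R))
    (r : R) (k : nat) (A : set (R * R)) :
  point_process bounded_borel2 Psi -> bounded_borel2 A ->
  measurable [set w | reach r (Psi w) k `&` A !=set0].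
Proof.
move=> ppPsi; elim: k A => [|k IH] A bA.
  have -> : [set w | reach r (Psi w) 0 `&` A !=set0] =
      [set w | Psi w `&` (A `&` euclidean_ball (0, 0) r) !=set0].
    by apply/funext => w; rewrite /= -setIA (setIC (euclidean_ball _ _)).
  apply: (measurable_hit ppPsi).
  apply: bounded_borel2_setI => //.
  by apply: open_measurable_plane; exact: open_euclidean_ball.
pose close := [set ij | forall p q, (A `&` rat_box ij.1) p -> rat_box ij.2 q ->
  euclidean_norm (p - q) < r + r].
have -> : [set w | reach r (Psi w) k.+1 `&` A !=set0] =
    \bigcup_(ij in close) ([set w | Psi w `&` (A `&` rat_box ij.1) !=set0] `&`
      [set w | reach r (Psi w) k `&` rat_box ij.2 !=set0]).
  apply/seteqP; split=> w.
    move=> [p [[Xp [q kq pq]] Ap]].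
    have : nbhs (p, q) [set u | euclidean_norm (u.1 - u.2) < r + r].
      apply: open_nbhs_nbhs; split=> //.
      apply: (@open_comp _ _ (fun u : (R * R) * (R * R) =>
        euclidean_norm (u.1 - u.2)) [set x | x < r + r]); last exact: open_lt.
      move=> u _; apply: (@continuous_comp _ _ _
        (fun u : (R * R) * (R * R) => u.1 - u.2)).
        by apply: cvgB; [exact: cvg_fst|exact: cvg_snd].
      exact: euclidean_norm_continuous.
    move=> [[B C] [/= /rat_box_nbhs[i [ip iB]] /rat_box_nbhs[j [jq jC]]]] BC.
    exists (i, j).
      move=> p' q' [_ ip'] jq'; apply: (BC (p', q')).
      by split; [exact: iB|exact: jC].
    by split; [exists p|exists q].
  move=> [[i j] ij [[p [Xp [Ap ip]]] [q [kq jq]]]].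
  by exists p; split=> //; split=> //; exists q => //; exact: ij.
apply: measurable_bigcup_countType => -[i j]; apply: measurableI.
  apply: (measurable_hit ppPsi); apply: bounded_borel2_setI => //.
  by case: (bounded_borel2_rat_box i).
by apply: IH; exact: bounded_borel2_rat_box.
Qed.

(* Needed for any bound on [theta]: the values of [P] on non-measurable sets are
   arbitrary nonnegative numbers. *)
Lemma measurable_component_meet d (T : measurableType d)
    (Psi : T -> set (R * R)) (r : R) (D : set (R * R)) :
  point_process bounded_borel2 Psi -> 0 < r ->
  measurable [set w |
    connected_component (manhattan_grid_model r (Psi w)) (0, 0) `&` D !=set0].
Proof.
move=> ppPsi r0; under eq_set do rewrite component_meetE //.
set DD := \bigcup_(z in D) _.
(* [DD] may be unbounded, whereas hits are known to be measurable for bounded Borel sets only; hence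
   it is cut by the rational boxes. *)
have -> : [set w | exists k, reach r (Psi w) k `&` DD !=set0] =
  \bigcup_ki [set w | reach r (Psi w) ki.1 `&` (rat_box ki.2 `&` DD) !=set0].
  apply/seteqP; split=> w.
    move=> [k [p [kp Dp]]]; have [|i [ip _]] := @rat_box_nbhs p setT.
      exact: filterT.
    by exists (k, i) => //; exists p.
  by move=> [[k i] _ [p [kp [_ Dp]]]]; exists k, p.
apply: measurable_bigcup_countType => -[k i]; apply: measurable_reach_hit => //.
apply: bounded_borel2_setI; first exact: bounded_borel2_rat_box.
apply: open_measurable_plane; apply: bigcup_open => z _.
exact: open_euclidean_ball.
Qed.

End measurability.

(** * The Manhattan measure of a box *)

Section manhattan_measure.
Context {R : realType}.
Implicit Types (X Y I J : set R).

Lemma finite_set_measurable X : finite_set X -> measurable X.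
Proof.
by move=> /finite_set_countable; apply: countable_measurable => x.
Qed.

Lemma integral_counting_indic X I (c : R) : finite_set (X `&` I) ->
  (\int[@counting R R]_(x in X) (c%:E * (\1_I x)%:E) =
   c%:E * counting (X `&` I))%E.
Proof.
move=> fXI; rewrite -(integral_cst _ (finite_set_measurable fXI)).
rewrite [RHS]integral_mkcondr; apply: eq_integral => x _.
by rewrite patchE indicE; case: ifPn; rewrite ?mule1 ?mule0.
Qed.

(** Each vertical line with abscissa in [I] meets the box in a copy of [J], of length [b], and each
    horizontal line with ordinate in [J] in a copy of [I], of length [a]. *)
Lemma manhattan_measure_box X Y I J (a b : R) :
  measurable I -> measurable J ->
  lebesgue_measure I = a%:E -> lebesgue_measure J = b%:E ->
  finite_set (X `&` I) -> finite_set (Y `&` J) ->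
  manhattan_measure X Y (I `*` J) =
  (b%:E * counting (X `&` I) + a%:E * counting (Y `&` J))%E.
Proof.
move=> mI mJ Ia Jb fX fY; rewrite /manhattan_measure.
have leb_indic K (k : R) (c : bool) : measurable K ->
    lebesgue_measure K = k%:E ->
    (\int[lebesgue_measure]_v (c && (v \in K))%:R%:E = k%:E * c%:R%:E)%E.
  move=> mK <-; case: c => /=; last by rewrite integral0 mule0.
  by rewrite mule1 -[K in RHS]setIT -integral_indic.
rewrite -2?integral_counting_indic //.
congr (_ + _)%E; apply: eq_integral => u _.
  rewrite indicE -(leb_indic _ _ _ mJ Jb); apply: eq_integral => v _.
  by rewrite indicE in_setX.
rewrite indicE -(leb_indic _ _ _ mI Ia); apply: eq_integral => v _.
by rewrite indicE in_setX andbC.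
Qed.

End manhattan_measure.

(** * Crossing a strip whose boxes are all hit *)

Section strip.
Context {R : realType}.

(* Any length [l > 1] and width [w] with [l ^ 2 + w ^ 2 <= 2] and
   [(2 * l) ^ 2 + w ^ 2 <= 8] would do. *)
Definition strip_box (i : nat) : set (R * R) :=
  `[i%:R * (6 / 5), i.+1%:R * (6 / 5)] `*` `[0, 1 / 2].

Lemma strip_boxE i (p : R * R) : strip_box i p ->
  [/\ i%:R * (6 / 5) <= p.1, p.1 <= (i%:R + 1) * (6 / 5), 0 <= p.2
    & p.2 <= 1 / 2].
Proof.
by case; rewrite /= !in_itv /= -[i.+1%:R]natr1 => /andP[? ?] /andP[].
Qed.

Lemma boundary_square (n : nat) : boundary (square n) (n%:R : R, 0 : R).
Proof.
have n0 : 0 <= n%:R :> R by [].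
split.
  by apply: subset_closure; split; rewrite /= in_itv /=; apply/andP; split; lra.
move=> /nbhs_ballP[e /= e0 eS].
have [|] := eS (n%:R + e / 2, 0).
  by split; [rewrite /ball /= ltr_norml; lra|exact: ballxx].
by rewrite /= in_itv /= => /andP[_]; lra.
Qed.

(** One point per box gives a chain: the first is within [r] of the origin as
    [(6/5)^2 + (1/2)^2 < 2], and points of consecutive boxes are closer than [2 r] as
    [(12/5)^2 + (1/2)^2 < 8]. The chain is followed up to the box above abscissa [n], where the ball
    covers the boundary point [(n, 0)]. *)
Lemma strip_component (r : R) (X : set (R * R)) (n : nat) :
  Num.sqrt 2 < r -> (0 < n)%N ->
  (forall i, (i < n)%N -> X `&` strip_box i !=set0) ->
  connected_component (manhattan_grid_model r X) (0, 0)
    `&` boundary (square n) !=set0.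
Proof.
move=> r2 n0 Xn.
have r0 : 0 < r by apply: le_lt_trans r2; exact: sqrtr_ge0.
have {}r2 : 2 < r ^+ 2.
  by rewrite -[ltLHS]sqr_sqrtr// ltr_sqr ?nnegrE ?sqrtr_ge0 // ltW.
have step i : (i < n)%N -> reach r X i `&` strip_box i !=set0.
  elim: i => [|i IH] ltin;
    have [p [Xp /[dup] pi /strip_boxE[a b c e]]] := Xn _ ltin.
    exists p; split=> //; split=> //.
    rewrite /euclidean_ball /= subr0 euclidean_norm_lt //.
    move: a b; rewrite mul0r add0r mul1r => a b.
    have : p.1 ^+ 2 <= (6 / 5) ^+ 2 by rewrite ler_sqr ?nnegrE; lra.
    by have : p.2 ^+ 2 <= (1 / 2) ^+ 2; [rewrite ler_sqr ?nnegrE; lra|lra].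
  have [q [iq /strip_boxE[a' b' c' e']]] := IH (ltnW ltin).
  exists p; split=> //; split=> //; exists q => //.
  rewrite euclidean_norm_lt ?addr_gt0 //=.
  move: a b; rewrite -[i.+1%:R]natr1 => a b.
  have : (p.1 - q.1) ^+ 2 <= (12 / 5) ^+ 2 by rewrite ler_sqr ?nnegrE; lra.
  have : (p.2 - q.2) ^+ 2 <= (1 / 2) ^+ 2.
    by rewrite -ler_sqrt ?sqr_ge0// !sqrtr_sqr ler_norml ger0_norm; lra.
  by move=> ? ?; nra.
rewrite component_meetE //.
(* The index of the box whose projection contains [n]; it is less than [n] because the boxes are
   longer than 1. *)
pose j := Num.truncn (n%:R / (6 / 5) : R).
have [jn nj] : j%:R <= n%:R / (6 / 5) :> R /\ n%:R / (6 / 5) < j.+1%:R :> R.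
  by apply/andP; rewrite truncn_itv // divr_ge0.
have ltjn : (j < n)%N.
  by rewrite -(ltr_nat R); have : 0 < n%:R :> R; [rewrite ltr0n|lra].
have [p [jp /strip_boxE[a b c e]]] := step _ ltjn.
exists j, p; split=> //; exists (n%:R, 0); first exact: boundary_square.
rewrite /euclidean_ball /= euclidean_norm_lt //= subr0.
move: nj; rewrite -[j.+1%:R]natr1 => nj.
have : (p.1 - n%:R) ^+ 2 <= (6 / 5) ^+ 2.
  by rewrite -ler_sqrt ?sqr_ge0// !sqrtr_sqr ler_norml ger0_norm; lra.
by have : p.2 ^+ 2 <= (1 / 2) ^+ 2; [rewrite ler_sqr ?nnegrE; lra|lra].
Qed.

End strip.

(** * From the conditional Poisson law to a lower bound on [theta] *)

Section theta_lower_bound.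
Context {R : realType} {d : measure_display} {T : measurableType d}.
Context (P : probability T R).

Lemma sub_sigma_measurable (G : set (set T)) :
  G `<=` measurable -> <<s G >> `<=` measurable.
Proof.
by move=> GT; apply: smallest_sub => //; exact: sigma_algebra_measurable.
Qed.

Lemma cond_probability_ub (G : set (set T)) A f E (c : R) :
  G `<=` measurable -> cond_probability P G A f -> G E ->
  (forall w, 0 <= f w) -> (forall w, E w -> f w <= c) ->
  (P (A `&` E) <= c%:E * P E)%E.
Proof.
move=> mG [mf fE] GE f0 fc; rewrite fE // -integral_cst; last exact: mG.
apply: ge0_le_integral => //=.
- exact: mG.
- by move=> w _; rewrite lee_fin.
- apply/measurable_EFinP; apply: (@measurable_funS _ _ _ _ setT) => // _ Y mY.
  by rewrite setTI; apply: mG; exact: mf.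
Qed.

(** The union bound conditionally on [E], multiplied through by [P E] so that [E] may be null. *)
Lemma measure_not_bigcup_ge (E : set T) (Z : nat -> set T) (n : nat) (c : R) :
  measurable E -> (forall i, measurable (Z i)) -> n%:R * c <= 1 / 2 ->
  (forall i, (i < n)%N -> (P (Z i `&` E) <= c%:E * P E)%E) ->
  (P E * (1 / 2)%:E <= P (E `&` ~` \big[setU/set0]_(i < n) Z i))%E.
Proof.
move=> mE mZ nc PZ; set U := \big[setU/set0]_(i < n) Z i.
have mU : measurable U by exact: bigsetU_measurable.
have PEfin : P E \is a fin_num by exact: fin_num_measure.
have PU : (P (E `&` U) <= (1 / 2)%:E * P E)%E.
  rewrite setIC /U big_distrl /=.
  apply: (@le_trans _ _ (\sum_(i < n) P (Z i `&` E))%E).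
    apply: (Boole_inequality P (A := fun i => Z i `&` E)) => i _.
    exact: measurableI.
  apply: (@le_trans _ _ (\sum_(i < n) (c * fine (P E))%:E)%E).
    by apply: lee_sum => i _; rewrite EFinM fineK // PZ.
  rewrite sumEFin sumr_const card_ord -[_ *+ n]mulr_natl mulrA EFinM fineK //.
  by rewrite lee_wpmul2r // lee_fin.
have PUfin : P (E `&` U) \is a fin_num.
  by apply: fin_num_measure; exact: measurableI.
rewrite -setDE measureD //; last by rewrite -ge0_fin_numE.
rewrite leeBrDr // (le_trans (leeD2l _ PU)) // muleC -ge0_muleDl ?lee_fin //.
by rewrite -EFinD -[X in X%:E](_ : 1 = _) ?mul1e //; lra.
Qed.

Lemma counting_card (X : set R) n : (X #= `I_n)%card ->
  counting X = n%:R%:E :> \bar R.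
Proof.
move=> Xn; rewrite /counting (card_fset_set Xn) asboolT //.
by exists n.
Qed.

Lemma bounded_borel1_itv (a b : R) : bounded_borel1 (`[a, b]%classic : set R).
Proof.
split; first exact: measurable_itv.
exists (`|a| + `|b|); split; first exact: num_real.
move=> M mM x; rewrite /= in_itv /= => /andP[ax xb].
rewrite ler_norml; have := ler_norm b; have := ler_norm (- a).
rewrite normrN; have := normr_ge0 a; have := normr_ge0 b; lra.
Qed.

Lemma theta_ge (r mu_x mu_y lambda : R) (Phi_x Phi_y : T -> set R)
    (Psi : T -> set (R * R)) (n k : nat) :
  Num.sqrt 2 < r -> 0 < lambda ->
  manhattan_process P mu_x mu_y lambda Phi_x Phi_y Psi ->
  (0 < n)%N -> n%:R * expR (- (lambda * (6 / 5 * k%:R))) <= 1 / 2 ->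
  ((poisson_weight (mu_y / 2) k / 2)%:E <= theta P r Psi n)%E.
Proof.
move=> r2 l0 [[ppx _ _] [ppy wy _] _ [ppPsi cPsi]] n0 nk.
set G := <<s _ >> in cPsi.
have GT : G `<=` measurable.
  apply: sub_sigma_measurable => E [];
    apply: sub_sigma_measurable => {}E [B [i [bB ->]]].
    by apply: ppx.2.
  by apply: ppy.2.
(* Exactly [k] horizontal lines run in the strip; below, [Z i] says that box [i] contains no
   point. *)
pose E := count_event Phi_y `[0, 1 / 2]%classic k.
have GE : G E.
  apply: sub_sigma_algebra; right; apply: sub_sigma_algebra.
  by exists `[0, 1 / 2]%classic, k; split=> //; exact: bounded_borel1_itv.
pose Z i := count_event Psi (strip_box i) 0.
have bbox i : bounded_borel2 (strip_box i : set (R * R)).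
  exact: bounded_borel2_itv.
have PE : P E = (poisson_weight (mu_y / 2) k)%:E.
  rewrite wy; last exact: bounded_borel1_itv.
  rewrite lebesgue_measure_itv /= lte_fin divr_gt0 // oppr0 adde0 /=.
  by rewrite mul1r.
have PZ i : (P (Z i `&` E) <= (expR (- (lambda * (6 / 5 * k%:R))))%:E * P E)%E.
  have := cPsi 1%N (fun=> strip_box i) (fun=> 0%N) (fun=> bbox i).
  rewrite bigcap_const; last by exists ord0.
  move=> /(_ _)/cond_probability_ub; apply=> //.
  - by move=> j j' _ _ _; rewrite !ord1.
  - move=> w; rewrite big_ord1 /poisson_weight expr0 mulr1 fact0 divr1.
    exact: expR_ge0.
  move=> w Ew; rewrite big_ord1 /poisson_weight expr0 mulr1 fact0 divr1.
  rewrite ler_expR lerN2.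
  (* The number [m] of vertical lines through the box is finite, so the mass of the box is finite
     too; this matters since [fine] sends an infinite mass to 0. *)
  have [m Xm] := ppx.1 w _
    (bounded_borel1_itv (i%:R * (6 / 5)) (i.+1%:R * (6 / 5))).
  have leb (a b : R) : a < b -> lebesgue_measure `[a, b]%classic = (b - a)%:E.
    by move=> ab; rewrite lebesgue_measure_itv /= lte_fin ab.
  rewrite (@manhattan_measure_box _ _ _ _ _ (6 / 5) (1 / 2)) //.
  (* The vertical lines only add the nonnegative mass [m / 2] to the [6/5 * k] of the horizontal
     ones. *)
  - rewrite (counting_card Xm) (counting_card Ew) -!EFinM /=.
    by rewrite ler_pM2l // lerDr mulr_ge0.
  - by rewrite leb -natr1; [congr EFin; lra|lra].
  - by rewrite leb ?subr0 //; lra.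
  - by exists m.
  - by exists k.
apply: le_trans (_ : (P E * (1 / 2)%:E <= _)%E).
  by rewrite PE -EFinM div1r.
apply: le_trans (measure_not_bigcup_ge (Z := Z) (GT _ GE) _ nk _) _.
- by move=> i; apply: ppPsi.2.
- by move=> i _; exact: PZ.
have mZ i : measurable (Z i) by apply: ppPsi.2.
rewrite /theta; apply: le_measure; rewrite ?inE.
- apply: measurableI; first exact: GT.
  by apply: measurableC; apply: bigsetU_measurable.
- apply: measurable_component_meet => //.
  by apply: le_lt_trans r2; exact: sqrtr_ge0.
move=> w [_]; rewrite -bigcup_mkord => nZ; apply: strip_component => // i ilt.
apply: contrapT => Xi; apply: nZ; exists i => //.
by rewrite /Z count_event0.
Qed.

End theta_lower_bound.

(** * Factorials and asymptotics in [n] *)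

Lemma fact_lb (M k K : nat) : (M <= k)%N -> (k <= K)%N ->
  (k`! * M ^ (K - k) <= K`!)%N.
Proof.
move=> Mk kK; rewrite -{2}(subnKC kK); elim: (K - k)%N => [|m IH].
  by rewrite expn0 muln1 addn0.
rewrite expnSr mulnA addnS factS mulnC; apply: leq_mul => //.
by rewrite (leq_trans Mk) // -addnS leq_addr.
Qed.

Lemma fact_ub (n : nat) : (n`! <= n ^ n)%N.
Proof.
suff : forall m, (m <= n)%N -> (m`! <= n ^ m)%N by apply.
elim=> [|m IH] mn //; rewrite factS expnS leq_mul //; exact: IH (ltnW mn).
Qed.

Section asymptotics.
Context {R : realType}.
Implicit Types (lambda nu a : R).

(** The condition [n * exp (- 6/5 * lambda * k) <= 1/2] solved for [k], with the successor of the
    integer part to round up. *)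
Definition nlines lambda (n : nat) : nat :=
  (Num.truncn ((ln n%:R + ln 2) / (lambda * (6 / 5)))).+1.

Lemma near_ln (A : R) : \forall n \near \oo, A <= ln (n%:R : R).
Proof.
near=> n; rewrite -ler_expR lnK.
  by near: n; exact: nbhs_infty_ger.
by rewrite posrE ltr0n; near: n; exists 1%N.
Unshelve. all: by end_near. Qed.

Lemma nlines_expR lambda (n : nat) : 0 < lambda -> (0 < n)%N ->
  n%:R * expR (- (lambda * (6 / 5 * (nlines lambda n)%:R))) <= 1 / 2 :> R.
Proof.
move=> l0 n0; have n0' : 0 < n%:R :> R by rewrite ltr0n.
have h : ln n%:R + ln 2 <= lambda * (6 / 5 * (nlines lambda n)%:R).
  rewrite mulrA mulrC -ler_pdivrMr ?mulr_gt0 // ltW //.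
  exact: truncnS_gt.
rewrite -lerN2 -ler_expR opprD expRD !expRN !lnK ?posrE // -expRN in h.
by rewrite mulrC -ler_pdivlMr // div1r; apply: le_trans h _; rewrite mulrC.
Qed.

(** With [L = ln n], [K] the integer part of [L / lambda] and [k] the number of lines, [K - k] is at
    least [L / (12 * lambda)] for large [n]. So [K! / k! >= M ^ (K - k) >= n ^ c] once
    [ln M >= 12 * lambda * c], for a constant [c] of any size. *)
Lemma fact_powR_poisson_lb lambda nu a : 0 < lambda -> 0 < nu ->
  \forall n \near \oo, expR (- nu) / 2 * n%:R <=
    (Num.truncn (lambda^-1 * ln n%:R))`!%:R * n%:R `^ a *
    (poisson_weight nu (nlines lambda n) / 2).
Proof.
move=> l0 nu0.
(* [b] is chosen so that [k <= b * L]. In [c], the terms [|a|] and [|ln nu| * b] compensate [n ^ a]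
   and [nu ^ k], and the term 1 leaves a factor [n]. *)
pose b := lambda^-1 * (5 / 3) + 1; pose c := 1 + `|a| + `|ln nu| * b.
pose M := (Num.truncn (expR (12 * lambda * c))).+1.
have lnM : 12 * lambda * c <= ln M%:R.
  by rewrite -ler_expR lnK ?posrE // ltW // truncnS_gt.
near=> n.
have n0 : (0 < n)%N by near: n; exists 1%N.
have n0' : 0 < n%:R :> R by rewrite ltr0n.
(* [L1] and [L2] serve the bound [k <= b * L], [L3] the gap [Kk], and [L4] the inequality
   [M <= k]. *)
have L1 : 1 <= ln n%:R :> R by near: n; exact: near_ln.
have L2 : ln 2 <= ln n%:R :> R by near: n; exact: near_ln.
have L3 : 24 * lambda + 10 * ln 2 <= ln n%:R by near: n; exact: near_ln.
have L4 : 6 / 5 * lambda * M%:R <= ln n%:R by near: n; exact: near_ln.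
have ln2 : 0 <= ln 2 :> R by rewrite ln_ge0 // ler1n.
set L := ln n%:R in L1 L2 L3 L4 *; set K := Num.truncn _; set k := nlines _ _.
have kge : 5 / 6 * (L + ln 2) <= lambda * k%:R.
  have : (L + ln 2) / (lambda * (6 / 5)) < k%:R by exact: truncnS_gt.
  by rewrite ltr_pdivrMr ?mulr_gt0 // => ?; lra.
have kle : lambda * k%:R <= 5 / 6 * (L + ln 2) + lambda.
  have : k%:R - 1 <= (L + ln 2) / (lambda * (6 / 5)).
    rewrite /k /nlines -natr1 addrK truncn_le divr_ge0 ?addr_ge0 ?mulr_ge0 //.
      by rewrite (le_trans _ L1).
    exact: ltW.
  by rewrite ler_pdivlMr ?mulr_gt0 // => ?; lra.
have Kge : L - lambda <= lambda * K%:R.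
  have : lambda^-1 * L < K.+1%:R by exact: truncnS_gt.
  by rewrite ltr_pdivrMl // -[K.+1%:R]natr1 => ?; lra.
have kb : k%:R <= b * L.
  rewrite -(ler_pM2l l0); apply: le_trans kle _.
  have -> : lambda * (b * L) = 5 / 3 * L + lambda * L.
    by rewrite /b; field; rewrite gt_eqF.
  have : lambda * 1 <= lambda * L by rewrite ler_pM2l.
  by lra.
(* The leading terms of [lambda * K] and [lambda * k] are [L] and [5/6 * L]; half of the difference
   [L / 6] absorbs the constants, by [L3]. *)
have Kk : L <= (12 * lambda) * (K%:R - k%:R) by lra.
have Mk : (M <= k)%N.
  by rewrite -(ler_nat R) -(ler_pM2l l0); lra.
have kK : (k <= K)%N.
  rewrite -(ler_nat R) -subr_ge0 -(pmulr_rge0 _ l0); lra.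
have /(fact_lb Mk) := kK; rewrite -(ler_nat R) natrM natrX => fK.
have powE (x : R) m : 0 < x -> x ^+ m = expR (m%:R * ln x).
  by move=> x0; rewrite expRM_natl lnK.
have b0 : 0 <= b by rewrite addr_ge0 // mulr_ge0 // ?invr_ge0 ltW.
have c0 : 0 <= c by rewrite !addr_ge0 // mulr_ge0.
have L0 : 0 <= L by exact: le_trans L1.
have exponent : L <= (K - k)%:R * ln M%:R + a * L + k%:R * ln nu.
  have h1 : L * c <= (K - k)%:R * ln M%:R.
    rewrite natrB //; apply: le_trans (ler_wpM2l _ lnM).
      rewrite mulrA [X in _ <= X * c]mulrC; exact: ler_wpM2r.
    by rewrite subr_ge0 ler_nat.
  have h2 : - (`|a| * L) <= a * L.
    by rewrite -mulNr ler_wpM2r // lerNl -normrN ler_norm.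
  have h3 : - (b * L * `|ln nu|) <= k%:R * ln nu.
    apply: (@le_trans _ _ (- (k%:R * `|ln nu|))).
      by rewrite lerN2 ler_wpM2r.
    by rewrite -mulrN ler_wpM2l // lerNl -normrN ler_norm.
  rewrite [leLHS](_ : _ = L * c - `|a| * L - b * L * `|ln nu|).
    by apply: lerD => //; exact: lerD.
  by rewrite /c; ring.
have nE : n%:R <= M%:R ^+ (K - k) * expR (a * L) * nu ^+ k.
  by rewrite !powE // -!expRD -[leLHS]lnK ?posrE // ler_expR.
rewrite /poisson_weight /powR gt_eqF // -/L.
apply: le_trans (ler_wpM2l _ nE) _; first by rewrite divr_ge0 ?expR_ge0.
have kf0 : 0 < k`!%:R :> R by rewrite ltr0n fact_gt0.
rewrite [leRHS](_ : _ =
    expR (- nu) / 2 * (K`!%:R / k`!%:R * expR (a * L) * nu ^+ k)).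
  rewrite ler_wpM2l ?divr_ge0 ?expR_ge0 //.
  rewrite !ler_wpM2r ?exprn_ge0 ?expR_ge0 ?(ltW nu0) //.
  by rewrite ler_pdivlMr // mulrC.
have E (x y z u v : R) : x * y * (u * v / z / 2) = u / 2 * (x / z * y * v).
  by rewrite -!mulrA; ring.
exact: E.
Unshelve. all: by end_near. Qed.

(** By [K! <= K ^ K], the logarithm of the left side is at most
    [L / lambda * (ln L - ln lambda) + a * L]. The surplus [eps * L / lambda * ln L] on the right
    covers the terms linear in [L] as soon as [eps * ln L >= a * lambda - ln lambda], which is
    [L3]. *)
Lemma fact_powR_ub lambda eps a : 0 < lambda -> 0 < eps ->
  \forall n \near \oo,
    (Num.truncn (lambda^-1 * ln n%:R))`!%:R * n%:R `^ a <=
    n%:R `^ ((1 + eps) * lambda^-1 * ln (ln n%:R)) :> R.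
Proof.
move=> l0 eps0; near=> n.
have n0 : (0 < n)%N by near: n; exists 1%N.
have n0' : 0 < n%:R :> R by rewrite ltr0n.
have L1 : 1 <= ln n%:R :> R by near: n; exact: near_ln.
(* This makes [K >= 1], so that [ln K] is nonnegative and the product [K * ln K] can be bounded
   factor by factor. *)
have L2 : lambda <= ln n%:R :> R by near: n; exact: near_ln.
have L3 : expR ((a * lambda - ln lambda) / eps) <= ln n%:R.
  by near: n; exact: near_ln.
rewrite /powR gt_eqF //; set L := ln n%:R in L1 L2 L3 *.
set K := Num.truncn _.
have L0 : 0 < L by exact: lt_le_trans L1.
have li0 : 0 < lambda^-1 by rewrite invr_gt0.
have lL : 1 <= lambda^-1 * L by rewrite ler_pdivlMl // mulr1.
have KL : K%:R <= lambda^-1 * L by rewrite truncn_le ltW // (lt_le_trans _ lL).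
have K0 : (0 < K)%N by rewrite truncn_gt0.
have KK : (K`! <= K ^ K)%N by exact: fact_ub.
have lnKL : K%:R * ln K%:R <= lambda^-1 * L * (ln L - ln lambda).
  rewrite -ln_div ?posrE // [L / _]mulrC; apply: ler_pM => //.
    by rewrite ln_ge0 // ler1n.
  by rewrite ler_ln ?posrE ?mulr_gt0 ?ltr0n.
have lnlnL : (a * lambda - ln lambda) / eps <= ln L.
  by rewrite -ler_expR lnK ?posrE.
apply: (@le_trans _ _ (expR (K%:R * ln K%:R) * expR (a * L))).
  rewrite ler_wpM2r ?expR_ge0 // expRM_natl lnK ?posrE ?ltr0n //.
  by rewrite -natrX ler_nat.
rewrite -expRD ler_expR.
have lnlnL' : a * lambda - ln lambda <= ln L * eps by rewrite -ler_pdivrMr.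
have := ler_wpM2l (ltW (mulr_gt0 li0 L0)) lnlnL'.
have -> : lambda^-1 * L * (a * lambda - ln lambda) =
    a * L - lambda^-1 * L * ln lambda by field; rewrite gt_eqF.
by lra.
Unshelve. all: by end_near. Qed.

End asymptotics.

(** * The two lower limits *)

Lemma limn_einf_pinfty (R : realType) (u : nat -> \bar R) :
  (forall A : R, \forall n \near \oo, (A%:E <= u n)%E) -> limn_einf u = +oo%E.
Proof.
by move=> uA; have [-> _] := cvg_limn_einf_sup ((cvgeyPge u).2 uA).
Qed.

Theorem proposition4 (R : realType) (d : measure_display)
    (T : measurableType d) (P : probability T R)
    (r mu_x mu_y lambda : R)
    (Phi_x Phi_y : T -> set R) (Psi : T -> set (R * R))
    (hr : Num.sqrt (2 : R) < r)
    (hmu_x : 0 < mu_x) (hmu_y : 0 < mu_y) (hlambda : 0 < lambda)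
    (hMGM : manhattan_process P mu_x mu_y lambda Phi_x Phi_y Psi) :
  (0 < limn_einf (fun n : nat =>
         ((Num.truncn (lambda^-1 * ln n%:R))`!%:R *
          n%:R `^ (lambda^-1 * ln (Num.min mu_x mu_y)))%:E *
         theta P r Psi n))%E /\
  (forall eps : R, 0 < eps ->
     limn_einf (fun n : nat =>
       (n%:R `^ ((1 + eps) * lambda^-1 * ln (ln n%:R)))%:E *
       theta P r Psi n)%E = +oo%E).
Proof.
set a := lambda^-1 * ln (Num.min mu_x mu_y).
(* Divergence, rather than mere positivity, is proved for the first sequence; the second then
   diverges by comparing the factors in front of [theta]. *)
have main (A : R) : \forall n \near \oo, (A%:E <=
    ((Num.truncn (lambda^-1 * ln n%:R))`!%:R * n%:R `^ a)%:E * theta P r Psi n)%E.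
  have nu0 : 0 < mu_y / 2 by rewrite divr_gt0.
  have c0 : 0 < expR (- (mu_y / 2)) / 2 by rewrite divr_gt0 ?expR_gt0.
  near=> n.
  have An : A <= expR (- (mu_y / 2)) / 2 * n%:R.
    rewrite mulrC -ler_pdivrMr //; near: n; exact: nbhs_infty_ger.
  have n0 : (0 < n)%N by near: n; exists 1%N.
  have lb := theta_ge hr hlambda hMGM n0 (nlines_expR hlambda n0).
  apply: (@le_trans _ _ (((Num.truncn (lambda^-1 * ln n%:R))`!%:R * n%:R `^ a)%:E *
    (poisson_weight (mu_y / 2) (nlines lambda n) / 2)%:E)%E).
    rewrite -EFinM lee_fin; apply: le_trans An _.
    by near: n; exact: fact_powR_poisson_lb.
  by rewrite lee_wpmul2l // lee_fin mulr_ge0 // powR_ge0.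
split; first by rewrite limn_einf_pinfty.
move=> eps eps0; apply: limn_einf_pinfty => A.
near=> n; apply: (@le_trans _ _ (((Num.truncn (lambda^-1 * ln n%:R))`!%:R *
    n%:R `^ a)%:E * theta P r Psi n)%E).
  by near: n; exact: main.
rewrite lee_wpmul2r ?measure_ge0 // lee_fin.
by near: n; exact: fact_powR_ub.
Unshelve. all: by end_near. Qed.
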